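(* Let $n\in\{1,2,\dots\}$ and $\delta\in(n,n+1)$. Then for every $u>0$ $$\frac{d}{du}\bigl[G_{n,\delta}(u)\bigr]=0\iff e^{-u}=1-\frac{u^1}{1!}+\dots+(-1)^{n-1}\frac{u^{n-1}}{(n-1)!}+(-1)^n\frac{\delta u^n}{n!\,(u+\delta)},$$ and the equation $$e^{-u}=1-\frac{u^1}{1!}+\dots+(-1)^{n-1}\frac{u^{n-1}}{(n-1)!}+(-1)^n\frac{\delta u^n}{n!\,(u+\delta)}$$ has exactly one positive solution $u$.
   Context: For $n\in\{1,2,\dots\}$, $\delta\in(n,n+1)$ and $u>0$, $$G_{n,\delta}(u)=(-1)^{n+1}\,\frac{e^{-u}-\Bigl(1-\frac{u^1}{1!}+\dots+(-1)^n\frac{u^n}{n!}\Bigr)}{u^{\delta}}.$$ *)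

(* Defs.v *)
(* Stdlib's real numbers, with Coquelicot for derivatives. *)
From Stdlib Require Import Factorial Reals.
From Coquelicot Require Import Coquelicot.

Open Scope R_scope.

(* [sum_f_R0 f m] has the m + 1 terms f 0, ..., f m. *)
Definition exp_neg_taylor (m : nat) (u : R) : R :=
  sum_f_R0 (fun k : nat => (-1) ^ k * (u ^ k / INR (fact k))) m.

(* [Rpower u delta] is exp (delta * ln u), the real power for u > 0; only
   positive u are meaningful here. *)
Definition G (n : nat) (delta : R) (u : R) : R :=
  (-1) ^ (n + 1) * ((exp (- u) - exp_neg_taylor n u) / Rpower u delta).

(* Main.v *)
Require Import Defs.
From Stdlib Require Import Factorial Reals Lia Psatz.
From Coquelicot Require Import Coquelicot.

Open Scope R_scope.

(** The numerator of [G n delta], sign included, is the Taylor remainder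
    [R_m(u) = (-1)^m (e^(-u) - (first m terms of the series))] with [m = n + 1].
    These remainders satisfy [R_(m+1)' = R_m] and [R_m + R_(m+1) = u^m / m!].
    By the first relation the derivative of [G n delta] has, for [u > 0], the
    sign of
      [H_(n,delta)(u) = u R_n(u) - delta R_(n+1)(u)],
    and by the second relation [H_(n,delta)(u) = 0] is the
    equation for [e^(-u)].

    The unique positive zero comes from the identity
    [H_(n+1,delta)' = H_(n,delta-1)], which lowers both parameters and so keeps
    [delta] in the interval from [n] to [n + 1]; at the bottom,
    [H_(0,delta)'(u) = e^(-u) (1 - delta - u)] changes sign exactly once, from
    plus to minus.  This sign pattern passes from a derivative to a primitive
    that vanishes at 0 and is somewhere negative: such a primitive increases
    from 0, then decreases strictly and must cross 0 once
    ([single_sign_change_primitive]).  Each [H_(n,delta)] takes a negative value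
    because it is equivalent to [(n - delta) u^n / n!] at infinity and
    [n < delta] ([critical_function_negative]). *)

(** * Taylor remainders of the decreasing exponential *)

(** The recursion makes [R_m + R_(m+1) = u^m / m!] definitional and keeps the
    alternating signs out of the calculus; [taylor_remainder_eq] links it to
    the partial sums. *)
Fixpoint taylor_remainder (m : nat) (u : R) : R :=
  match m with
  | O => exp (- u)
  | S p => u ^ p / INR (fact p) - taylor_remainder p u
  end.

Lemma taylor_remainder_eq (n : nat) (u : R) :
  taylor_remainder (S n) u = (-1) ^ (S n) * (exp (- u) - exp_neg_taylor n u).
Proof.
  induction n as [|n IH].
  - unfold exp_neg_taylor; simpl; field.
  - change (taylor_remainder (S (S n)) u)
      with (u ^ S n / INR (fact (S n)) - taylor_remainder (S n) u).
    rewrite IH.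
    assert (E : exp_neg_taylor (S n) u =
      exp_neg_taylor n u + (-1) ^ S n * (u ^ S n / INR (fact (S n))))
      by reflexivity.
    rewrite E.
    assert (sq : (-1) ^ S n * (-1) ^ S n = 1)
      by (rewrite <- Rpow_mult_distr; replace (-1 * -1) with 1 by ring; apply pow1).
    change ((-1) ^ S (S n)) with (-1 * (-1) ^ S n).
    set (s := (-1) ^ S n) in *; set (x := u ^ S n / _).
    replace (-1 * s * (exp (- u) - (exp_neg_taylor n u + s * x)))
      with (s * s * x - s * (exp (- u) - exp_neg_taylor n u)) by ring.
    rewrite sq; ring.
Qed.

Lemma is_derive_pow_div_fact (m : nat) (u : R) :
  is_derive (fun v => v ^ S m / INR (fact (S m))) u (u ^ m / INR (fact m)).
Proof.
  assert (fact_m := INR_fact_neq_0 m).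
  assert (Sm := not_0_INR (S m) ltac:(lia)).
  auto_derive; [easy|].
  change (Init.Nat.pred (S m)) with m.
  change (fact m + m * fact m)%nat with (S m * fact m)%nat.
  rewrite mult_INR.
  change (match m with 0%nat => 1 | S _ => INR m + 1 end) with (INR (S m)).
  field; easy.
Qed.

Lemma is_derive_taylor_remainder (m : nat) (u : R) :
  is_derive (taylor_remainder (S m)) u (taylor_remainder m u).
Proof.
  revert u; induction m as [|m IH]; intros u.
  - simpl; auto_derive; [easy | field].
  - apply (is_derive_minus (fun v => v ^ S m / INR (fact (S m)))
             (taylor_remainder (S m))).
    + apply is_derive_pow_div_fact.
    + apply IH.
Qed.

Lemma taylor_remainder_0 (m : nat) : taylor_remainder (S m) 0 = 0.
Proof.
  induction m as [|m IH].
  - simpl; rewrite Ropp_0, exp_0; field.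
  - change (taylor_remainder (S (S m)) 0)
      with (0 ^ S m / INR (fact (S m)) - taylor_remainder (S m) 0).
    rewrite IH, pow_ne_zero by easy.
    unfold Rdiv; ring.
Qed.

(** * Sign patterns of primitives *)

Lemma mean_value (f g : R -> R) (a b : R) :
  (forall u, is_derive f u (g u)) -> a < b ->
  exists c, f b - f a = g c * (b - a) /\ a < c < b.
Proof.
  intros df ab; apply MVT_cor2; [easy|].
  intros c _; apply is_derive_Reals, df.
Qed.

Lemma taylor_remainder_pos (m : nat) (u : R) : 0 < u -> 0 < taylor_remainder m u.
Proof.
  revert u; induction m as [|m IH]; intros u u0.
  - apply exp_pos.
  - destruct (mean_value _ _ 0 u (is_derive_taylor_remainder m) u0)
      as (c & Hc & c0 & _).
    rewrite taylor_remainder_0 in Hc.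
    assert (pos := Rmult_lt_0_compat _ _ (IH c c0) u0).
    lra.
Qed.

Definition single_sign_change (f : R -> R) : Prop :=
  exists c, 0 < c /\ f c = 0 /\
    (forall u, 0 < u < c -> 0 < f u) /\ (forall u, c < u -> f u < 0).

Lemma single_sign_change_primitive (f g : R -> R) :
  (forall u, is_derive f u (g u)) -> f 0 = 0 -> (exists M, 0 < M /\ f M < 0) ->
  single_sign_change g -> single_sign_change f.
Proof.
  intros df f0 (M & M0 & fM) (c & c0 & _ & gpos & gneg).
  assert (f_pos : forall u, 0 < u <= c -> 0 < f u).
  { intros u Hu.
    destruct (mean_value f g 0 u df) as (x & Hx & xu); [lra|].
    assert (0 < g x) by (apply gpos; lra).
    nra. }
  assert (f_decr : forall u v, c <= u -> u < v -> f v < f u).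
  { intros u v cu uv.
    destruct (mean_value f g u v df uv) as (x & Hx & xuv).
    assert (g x < 0) by (apply gneg; lra).
    nra. }
  assert (cM : c < M).
  { destruct (Rlt_le_dec c M) as [|Mc]; [easy|].
    assert (0 < f M) by (apply f_pos; lra); lra. }
  assert (fc : 0 < f c) by (apply f_pos; lra).
  destruct (IVT_gen f c M 0) as (d & Hd & fd).
  - intros x; apply derivable_continuous_pt; exists (g x).
    apply is_derive_Reals, df.
  - rewrite Rmin_right, Rmax_left; lra.
  - rewrite Rmin_left in Hd by lra.
    exists d; repeat split; try lra.
    + intros u Hu; destruct (Rle_lt_dec u c) as [uc|cu].
      * apply f_pos; lra.
      * rewrite <- fd; apply f_decr; lra.
    + intros u du; rewrite <- fd; apply f_decr; lra.
Qed.

(** * The function governing the sign of the derivative *)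

(** Up to the positive factor [1 / u^(delta+1)], the derivative of
    [taylor_remainder (S n) u / u^delta]. *)
Definition critical_function (n : nat) (delta u : R) : R :=
  u * taylor_remainder n u - delta * taylor_remainder (S n) u.

Lemma is_derive_critical_function_0 (delta u : R) :
  is_derive (critical_function 0 delta) u (exp (- u) * (1 - delta - u)).
Proof. unfold critical_function; simpl; auto_derive; [easy | field]. Qed.

(** By the product rule the factor [u] contributes an extra
    [taylor_remainder (S n)], which lowers [delta] by one. *)
Lemma is_derive_critical_function (n : nat) (delta u : R) :
  is_derive (critical_function (S n) delta) u (critical_function n (delta - 1) u).
Proof.
  unfold critical_function.
  assert (dr1 := is_derive_taylor_remainder n u).
  assert (dr2 := is_derive_taylor_remainder (S n) u).
  set (r1 := taylor_remainder (S n)) in *.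
  set (r2 := taylor_remainder (S (S n))) in *.
  set (r0 := taylor_remainder n u) in *.
  auto_derive.
  - split; [|split]; try easy; eexists; eassumption.
  - rewrite (is_derive_unique (fun v : R => r1 v) u _ dr1),
      (is_derive_unique (fun v : R => r2 v) u _ dr2); ring.
Qed.

Lemma critical_function_0 (n : nat) (delta : R) : critical_function n delta 0 = 0.
Proof. unfold critical_function; rewrite taylor_remainder_0; ring. Qed.

Lemma critical_function_eq (n : nat) (delta u : R) :
  critical_function n delta u
  = (u + delta) * taylor_remainder n u - delta * (u ^ n / INR (fact n)).
Proof. unfold critical_function; simpl; ring. Qed.

(** For [n = m + 1], positivity of the next remainder gives
    [R_n(u) < u^m / m!], so that [H_(n,delta)(u)] is at most
    [u^m / m! * (u + delta - delta u / n)], and the last factor is negative for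
    large [u] since [n < delta].  For [n = 0] that bound is missing, but the
    exponential decay of [R_0] is more than enough. *)
Lemma critical_function_negative (n : nat) (delta : R) :
  INR n < delta -> exists M, 0 < M /\ critical_function n delta M < 0.
Proof.
  destruct n as [|m]; intros Hd.
  - simpl in Hd.
    exists (4 / delta); set (M := 4 / delta).
    assert (M0 : 0 < M) by (apply Rdiv_lt_0_compat; lra).
    assert (dM : delta * M = 4) by (unfold M; field; lra).
    split; [easy|].
    rewrite critical_function_eq; simpl.
    replace (delta * (1 / 1)) with delta by field.
    (* Squaring exp (M/2) > 1 + M/2 gives the quadratic growth that beats
       M + delta; the choice M = 4/delta makes delta M^2 / 4 equal to M. *)
    assert (half := exp_ineq1 (M / 2) ltac:(lra)).
    assert (sq : exp (M / 2) * exp (M / 2) = exp M)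
      by (rewrite <- exp_plus; f_equal; field).
    assert (inv : exp (- M) * exp M = 1)
      by (rewrite <- exp_plus, Rplus_opp_l; apply exp_0).
    assert (e0 := exp_pos (- M)).
    assert (big : M + delta < delta * exp M) by nra.
    assert (small := Rmult_lt_compat_l _ _ _ e0 big).
    nra.
  - assert (n0 : 0 < INR (S m)) by (apply lt_0_INR; lia).
    set (N := INR (S m)) in *.
    set (M := delta * N / (delta - N) + 1).
    assert (M0 : 0 < M).
    { assert (0 < delta * N / (delta - N)); [|unfold M; lra].
      apply Rdiv_lt_0_compat; [apply Rmult_lt_0_compat|]; lra. }
    exists M; split; [easy|].
    rewrite critical_function_eq.
    assert (b := taylor_remainder_pos m M M0).
    assert (fm : 0 < INR (fact m)) by apply INR_fact_lt_0.
    assert (pw : 0 < M ^ m) by (apply pow_lt; easy).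
    set (t := M ^ m / INR (fact m)).
    assert (t0 : 0 < t) by (apply Rdiv_lt_0_compat; easy).
    assert (lead : M ^ S m / INR (fact (S m)) = t * M / N).
    { change (fact (S m)) with (S m * fact m)%nat.
      rewrite mult_INR; fold N; unfold t; simpl; field; lra. }
    rewrite lead.
    assert (r : taylor_remainder (S m) M < t) by (simpl; unfold t; lra).
    assert (key : M + delta - delta * (M / N) < 0).
    { replace (M + delta - delta * (M / N)) with (- ((delta - N) / N))
        by (unfold M; field; lra).
      assert (0 < (delta - N) / N) by (apply Rdiv_lt_0_compat; lra).
      lra. }
    apply Rlt_trans with ((M + delta) * t - delta * (t * M / N)).
    + apply Rplus_lt_compat_r, Rmult_lt_compat_l; lra.
    + replace ((M + delta) * t - delta * (t * M / N))
        with (t * (M + delta - delta * (M / N))) by (field; lra).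
      nra.
Qed.

Lemma critical_function_single_sign_change (n : nat) (delta : R) :
  INR n < delta < INR n + 1 -> single_sign_change (critical_function n delta).
Proof.
  revert delta; induction n as [|n IH]; intros delta Hd.
  - apply (single_sign_change_primitive _ (fun u => exp (- u) * (1 - delta - u))).
    + apply is_derive_critical_function_0.
    + apply critical_function_0.
    + apply critical_function_negative; lra.
    + simpl in Hd; exists (1 - delta); repeat split.
      * lra.
      * ring.
      * intros u Hu; apply Rmult_lt_0_compat; [apply exp_pos | lra].
      * intros u Hu; assert (e := exp_pos (- u)); nra.
  - apply (single_sign_change_primitive _ (critical_function n (delta - 1))).
    + apply is_derive_critical_function.
    + apply critical_function_0.
    + apply critical_function_negative; lra.
    + rewrite S_INR in Hd; apply IH; lra.
Qed.

(** * Critical points *)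

Lemma G_eq (n : nat) (delta u : R) :
  G n delta u = taylor_remainder (S n) u / Rpower u delta.
Proof.
  rewrite taylor_remainder_eq; unfold G, Rdiv.
  rewrite Nat.add_1_r; ring.
Qed.

Lemma is_derive_G (n : nat) (delta u : R) : 0 < u ->
  is_derive (G n delta) u (critical_function n delta u / (u * Rpower u delta)).
Proof.
  intros u0.
  apply (is_derive_ext (fun v => taylor_remainder (S n) v / Rpower v delta)).
  { intros v; symmetry; apply G_eq. }
  assert (dr := is_derive_taylor_remainder n u).
  unfold critical_function, Rpower.
  set (r1 := taylor_remainder (S n)) in *.
  assert (p0 := exp_pos (delta * ln u)).
  auto_derive.
  - repeat split; try easy; [eexists; eassumption | lra].
  - rewrite (is_derive_unique (fun v : R => r1 v) u _ dr); field; lra.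
Qed.

Lemma critical_function_zero_iff (n : nat) (delta u : R) :
  (1 <= n)%nat -> 0 < delta -> 0 < u ->
  critical_function n delta u = 0 <->
  exp (- u) = exp_neg_taylor (n - 1) u
              + (-1) ^ n * (delta * u ^ n / (INR (fact n) * (u + delta))).
Proof.
  intros hn d0 u0.
  rewrite critical_function_eq.
  assert (rem : taylor_remainder n u
      = (-1) ^ n * (exp (- u) - exp_neg_taylor (n - 1) u)).
  { destruct n as [|m]; [lia|].
    rewrite taylor_remainder_eq; simpl; rewrite Nat.sub_0_r; reflexivity. }
  rewrite rem.
  assert (fn := INR_fact_lt_0 n).
  assert (sq : (-1) ^ n * (-1) ^ n = 1)
    by (rewrite <- Rpow_mult_distr; replace (-1 * -1) with 1 by ring; apply pow1).
  set (s := (-1) ^ n) in *.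
  set (y := delta * u ^ n / (INR (fact n) * (u + delta))).
  assert (Hy : delta * (u ^ n / INR (fact n)) = (u + delta) * y)
    by (unfold y; field; lra).
  rewrite Hy.
  set (d := exp (- u) - exp_neg_taylor (n - 1) u).
  assert (Hd : exp (- u) = exp_neg_taylor (n - 1) u + d) by (unfold d; ring).
  rewrite Hd.
  split; intros H.
  - assert (E : s * d = y) by (apply Rmult_eq_reg_l with (u + delta); lra).
    rewrite <- E, <- Rmult_assoc, sq; ring.
  - assert (E : d = s * y) by lra.
    rewrite E, <- (Rmult_assoc s s y), sq; ring.
Qed.

Theorem proposition13 (n : nat) (delta : R)
    (hn : (1 <= n)%nat) (hdelta : INR n < delta < INR n + 1) :
  (forall u : R, 0 < u ->
     ex_derive (G n delta) u /\
     (Derive (G n delta) u = 0 <->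
      exp (- u) = exp_neg_taylor (n - 1) u
                  + (-1) ^ n * (delta * u ^ n / (INR (fact n) * (u + delta))))) /\
  (exists! u : R, 0 < u /\
      exp (- u) = exp_neg_taylor (n - 1) u
                  + (-1) ^ n * (delta * u ^ n / (INR (fact n) * (u + delta)))).
Proof.
  assert (d0 : 0 < delta) by (assert (n0 := pos_INR n); lra).
  split.
  - intros u u0.
    assert (dG := is_derive_G n delta u u0).
    split; [eexists; exact dG|].
    rewrite (is_derive_unique _ _ _ dG), <- critical_function_zero_iff by easy.
    assert (den : 0 < u * Rpower u delta)
      by (apply Rmult_lt_0_compat; [easy | apply exp_pos]).
    split; intros H.
    + apply Rmult_eq_reg_r with (/ (u * Rpower u delta)).
      * rewrite Rmult_0_l; exact H.
      * apply Rinv_neq_0_compat; lra.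
    + rewrite H; apply Rmult_0_l.
  - destruct (critical_function_single_sign_change n delta hdelta)
      as (c & c0 & Hc & Hpos & Hneg).
    exists c; split.
    + split; [easy | apply critical_function_zero_iff; easy].
    + intros v (v0 & Hv).
      apply critical_function_zero_iff in Hv; [|easy..].
      destruct (Rtotal_order c v) as [cv | [cv | vc]]; [|easy|].
      * assert (neg := Hneg v cv); lra.
      * assert (pos := Hpos v (conj v0 vc)); lra.
Qed.
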